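(* Let $G$ be a finite graph with vertices $v_1,\dots,v_m$ and let $C$ be a configuration on $G$. Then $C$ is cover solvable if and only if there exist integers $n_{ij}\ge 0$, $1\le i,j\le m$, with $n_{ij}=n_{ji}=0$ whenever $\{v_i,v_j\}\notin E(G)$, such that for all $1\le k\le m$, \[C(v_k)+\sum_{l=1}^m n_{lk}-2\sum_{l=1}^m n_{kl}\ge 1.\]
   Context: A configuration on $G$ is a function $C:V(G)\to\mathbb{N}\cup\{0\}$ giving the number of pebbles on each vertex. A pebbling move removes two pebbles from some vertex (which must currently hold at least two pebbles) and places one pebble on an adjacent vertex. $C$ is cover solvable if some finite sequence of pebbling moves starting from $C$ results in at least one pebble on every vertex of $G$ simultaneously. *)

(* Defs.v *)
From mathcomp Require Import all_boot all_order all_algebra.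
Set Implicit Arguments.
Unset Strict Implicit.
Unset Printing Implicit Defensive.

Record sgraph := SGraph {
  vertex :> finType;
  adj : rel vertex;
  adj_sym : symmetric adj;
  adj_irrefl : irreflexive adj
}.

Definition configuration (G : sgraph) := {ffun G -> nat}.

(* The configuration obtained from [C] by a move from [u] to [v].  The natural
   subtraction is exact, since moves require [2 <= C u]; the source and the
   target of a move are distinct because adjacency is irreflexive. *)
Definition move_result (G : sgraph) (C : configuration G) (u v : G) :
    configuration G :=
  [ffun w => if w == u then C w - 2 else if w == v then (C w).+1 else C w].

Definition pebbling_move (G : sgraph) : rel (configuration G) :=
  fun C D => [exists u : G, exists v : G,
    [&& adj u v, 2 <= C u & D == move_result C u v]].

(* [s] lists the configurations following [C] along a sequence of moves;
   it may be empty, in which case [last C s] is [C] itself. *)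
Definition cover_solvable (G : sgraph) (C : configuration G) : Prop :=
  exists s : seq (configuration G),
    path (@pebbling_move G) C s /\ forall v : G, 1 <= last C s v.

(* Main.v *)
Require Import Defs.
From mathcomp Require Import all_boot all_order all_algebra.
From mathcomp Require Import zify.
Import Order.TTheory GRing.Theory Num.Theory.
Local Open Scope ring_scope.
Set Implicit Arguments.
Unset Strict Implicit.
Unset Printing Implicit Defensive.

(** Read [n i j] as the number of moves from [v_i] to [v_j].  The inequalities
    say that performing all these moves, in any order and ignoring
    feasibility, leaves a pebble on every vertex, and they are invariant under
    performing one of the moves.  If none of the remaining moves is legal, every
    vertex with an outgoing move holds at most one pebble, so its inequality
    makes its in-flow at least twice its out-flow.  Summing over all vertices,
    the total flow is at least twice itself, so no move remains. *)

Section Flow.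
Variable G : sgraph.
Implicit Types (C : configuration G) (n : G -> G -> nat).

Definition supported_on_edges n := forall i j : G, ~~ adj i j -> n i j = 0%N.

(** The terms with a minus sign are moved to the other side, so that no truncated subtraction of
    naturals occurs. *)
Definition covering_flow C n :=
  forall k : G, (1 + 2 * \sum_(l : G) n k l <= C k + \sum_(l : G) n l k)%N.

Definition add_arc (u v : G) n : G -> G -> nat :=
  fun i j => (n i j + ((i == u) && (j == v)))%N.

Lemma outflow_add_arc (u v : G) n (k : G) :
  (\sum_(l : G) add_arc u v n k l = \sum_(l : G) n k l + (k == u))%N.
Proof.
rewrite big_split; congr (_ + _)%N; rewrite (bigD1 v) //= eqxx andbT.
by rewrite big1 ?addn0 // => l /negbTE->; rewrite andbF.
Qed.

Lemma inflow_add_arc (u v : G) n (k : G) :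
  (\sum_(l : G) add_arc u v n l k = \sum_(l : G) n l k + (k == v))%N.
Proof.
rewrite big_split; congr (_ + _)%N; rewrite (bigD1 u) //= eqxx.
by rewrite big1 ?addn0 // => l /negbTE->.
Qed.

(** The move takes two pebbles from [u] and gives one to [v]; the extra arc adds 2 to the left side
    at [u] and 1 to the right side at [v]. *)
Lemma covering_flow_move C n (u v : G) : adj u v -> (2 <= C u)%N ->
  covering_flow (move_result C u v) n <-> covering_flow C (add_arc u v n).
Proof.
move=> uv Cu; have vDu : v != u.
  by apply: contraTneq uv => ->; rewrite adj_irrefl.
by split=> flow k; move: (flow k);
   rewrite outflow_add_arc inflow_add_arc ffunE;
   case: eqVneq => [->|_]; rewrite ?[u == v]eq_sym ?(negbTE vDu);
   try case: eqVneq => _; lia.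
Qed.

Lemma supported_add_arc n (u v : G) : adj u v ->
  supported_on_edges n -> supported_on_edges (add_arc u v n).
Proof.
move=> uv supp i j ij; rewrite /add_arc supp //.
by case: eqVneq ij => // ->; case: eqVneq => // ->; rewrite uv.
Qed.

Lemma covering_flow_sum_eq0 C n : covering_flow C n ->
    (forall u v : G, (0 < n u v)%N -> (C u < 2)%N) ->
  (\sum_(k : G) \sum_(l : G) n k l = 0)%N.
Proof.
move=> flow stuck.
suff: (2 * \sum_(k : G) \sum_(l : G) n k l <= \sum_(k : G) \sum_(l : G) n k l)%N
  by lia.
(* Exchanging the sums on the right turns total out-flow into total in-flow, so the comparison can
   be made vertex by vertex. *)
rewrite [leqRHS]exchange_big big_distrr; apply: leq_sum => k _ /=.
have := flow k; have [-> | ] := posnP (\sum_(l : G) n k l)%N; first lia.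
rewrite lt0n sum_nat_eq0 negb_forall => /existsP[l]; rewrite -lt0n => /stuck.
lia.
Qed.

Lemma cover_solvable_flow C : cover_solvable C ->
  exists2 n, supported_on_edges n & covering_flow C n.
Proof.
case=> s; elim: s C => [|D s IHs] C /= [].
  move=> _ cover; exists (fun _ _ => 0%N) => // k.
  by rewrite !big1 // addn0 muln0 cover.
case/andP=> /existsP[u /existsP[v /and3P[uv Cu /eqP->]]] path_s cover.
have [n supp flow] := IHs _ (conj path_s cover).
exists (add_arc u v n); first exact: supported_add_arc.
exact/covering_flow_move.
Qed.

Lemma flow_cover_solvable C n :
  supported_on_edges n -> covering_flow C n -> cover_solvable C.
Proof.
(* Induction on a strict bound for the number of moves still to be performed. *)
have [N] := ubnP (\sum_(k : G) \sum_(l : G) n k l)%N.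
elim: N C n => // N IHN C n sum_lt supp flow.
have [/existsP[u /existsP[v /andP[n_uv Cu]]] | stuck] :=
    boolP [exists u, exists v, (0 < n u v)%N && (2 <= C u)%N]; last first.
  exists [::]; split=> // v /=.
  have sum0: (\sum_(k : G) \sum_(l : G) n k l = 0)%N.
    apply: (covering_flow_sum_eq0 flow) => u w n_uw.
    rewrite ltnNge; apply: contra stuck => Cu.
    by apply/existsP; exists u; apply/existsP; exists w; rewrite n_uw.
  have n0 k l : n k l = 0%N.
    move/eqP: sum0; rewrite sum_nat_eq0 => /forallP/(_ k).
    by rewrite sum_nat_eq0 => /forallP/(_ l)/eqP.
  by move: (flow v); rewrite [X in (_ <= _ + X)%N]big1 // addn0; lia.
have uv : adj u v by apply: contraTT n_uv => /supp->.
(* One move from [u] to [v] is used up; the subtraction is exact because [n u v] is positive. *)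
pose m i j := (n i j - ((i == u) && (j == v)))%N.
have mE i j : add_arc u v m i j = n i j.
  by rewrite /add_arc /m subnK //; case: eqP => // ->; case: eqP => // ->.
have flow_m : covering_flow (move_result C u v) m.
  apply/covering_flow_move => // k.
  by under eq_bigr do rewrite mE; under [in leqRHS]eq_bigr do rewrite mE.
have supp_m : supported_on_edges m by move=> i j /supp n_ij; rewrite /m n_ij.
have sum_m : (\sum_(k : G) \sum_(l : G) m k l < N)%N.
  suff: (\sum_(k : G) \sum_(l : G) m k l < \sum_(k : G) \sum_(l : G) n k l)%N
    by lia.
  (* With [n] written as [m] plus one arc, its total exceeds that of [m] by the term 1 at [u]. *)
  under [ltnRHS]eq_bigr do under eq_bigr do rewrite -mE.
  under [ltnRHS]eq_bigr do rewrite outflow_add_arc.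
  by rewrite big_split /= [X in (_ + X)%N](bigD1 u) //= eqxx; lia.
have [s [path_s cover]] := IHN _ _ sum_m supp_m flow_m.
exists (move_result C u v :: s); split=> //=; rewrite path_s andbT.
by apply/existsP; exists u; apply/existsP; exists v; rewrite uv Cu /=.
Qed.

End Flow.

Theorem theorem7 (G : sgraph) (C : configuration G) :
  cover_solvable C <->
  exists n : G -> G -> int,
    [/\ forall i j : G, 0 <= n i j,
        forall i j : G, ~~ adj i j -> n i j = 0 /\ n j i = 0
      & forall k : G,
          1 <= (C k)%:Z + \sum_(l : G) n l k - 2 * \sum_(l : G) n k l].
Proof.
have sumZ (F : G -> nat) : \sum_l (F l)%:Z = (\sum_l F l)%N%:Z.
  by rewrite -!natz natr_sum; apply: eq_bigr => l _; rewrite natz.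
split=> [/cover_solvable_flow[n supp flow] | [n [n_ge0 supp flow]]].
  exists (fun i j => (n i j)%:Z); split=> // [i j ij | k].
    by rewrite !supp // adj_sym.
  by have := flow k; rewrite !sumZ; lia.
(* Nonnegativity lets absolute values serve as the natural-valued flow. *)
have absE i j : n i j = `|n i j|%N%:Z by rewrite gez0_abs.
apply: (@flow_cover_solvable _ _ (fun i j => `|n i j|%N)).
  by move=> i j /supp[->].
move=> k; have := flow k; rewrite (eq_bigr _ (fun l _ => absE l k)).
by rewrite (eq_bigr _ (fun l _ => absE k l)) !sumZ; lia.
Qed.
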